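(* Let $g,\gamma\in\mathbb{C}^N$ be two windows such that $\langle T_n\gamma,T_ng\rangle\neq 0$ for all $n\in\{1,\dots,N\}$. Then for every $f\in\mathbb{C}^N$, $$f(i)=\frac{1}{N\,\langle T_i\gamma,T_ig\rangle}\sum_{n=1}^N\sum_{k=0}^{N-1}\langle f,g_{n,k}\rangle\,\gamma_{n,k}(i),\qquad \forall i=1,\dots,N.$$
   Context: Let $G=(V,E)$ be a finite, connected, undirected, weighted simple graph with vertex set $V=\{1,\dots,N\}$, and let $W=(W_{ij})$ be its weighted adjacency matrix: real, symmetric, zero diagonal, $W_{ij}\ge 0$, with $W_{ij}\neq0$ exactly when $i,j$ are adjacent. Let $D=\operatorname{diag}(d_1,\dots,d_N)$ with $d_i=\sum_{j}W_{ij}$, and let $\mathcal{L}=D-W$ be the graph Laplacian. Fix an orthonormal basis $(\chi_0,\dots,\chi_{N-1})$ of $\mathbb{C}^N$ consisting of eigenvectors of $\mathcal{L}$, ordered so that the eigenvalues satisfy $0=\lambda_0<\lambda_1\le\dots\le\lambda_{N-1}$ (so $|\chi_0(i)|=1/\sqrt N$ for all $i$). Signals are vectors $f=(f(1),\dots,f(N))\in\mathbb{C}^N$; the inner product $\langle f,h\rangle=\sum_{i=1}^N f(i)\overline{h(i)}$ is conjugate-linear in the second argument. Graph Fourier transform: $\hat f(\ell)=\langle f,\chi_\ell\rangle$, $\ell=0,\dots,N-1$. Generalized translation, for $n\in\{1,\dots,N\}$: $(T_nf)(i)=\sqrt N\sum_{\ell=0}^{N-1}\hat f(\ell)\overline{\chi_\ell(n)}\chi_\ell(i)$.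 Generalized modulation, for $k\in\{0,\dots,N-1\}$: $(M_kf)(i)=\sqrt N f(i)\chi_k(i)$. Windowed graph Fourier atoms of a window $g\in\mathbb{C}^N$: $g_{n,k}=M_kT_ng$, for $n\in\{1,\dots,N\}$, $k\in\{0,\dots,N-1\}$; similarly $\gamma_{n,k}=M_kT_n\gamma$. *)

(* Defs.v *)
From HB Require Import structures.
From mathcomp Require Import all_boot all_order all_algebra.
From mathcomp Require Import sesquilinear spectral.
From mathcomp Require Import complex reals.

Set Implicit Arguments.
Unset Strict Implicit.
Unset Printing Implicit Defensive.

Import Order.TTheory GRing.Theory Num.Theory.
Local Open Scope ring_scope.

(* The vertices 1, ..., N and the spectral indices 0, ..., N-1 are both
   represented by 'I_N.  A signal is a row vector f : 'rV[R[i]]_N, with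
   f(i) = f 0 i.  The inner product is spectral.v's dotmx: by dotmxE,
   dotmx f h = \sum_i f 0 i * (h 0 i)^*, conjugate-linear in h. *)

Record weighted_graph (R : realType) (N : nat) := WeightedGraph {
  edge : rel 'I_N;
  edge_sym : symmetric edge;
  edge_irr : irreflexive edge;
  edge_connected : forall i j : 'I_N, connect edge i j;
  weight : 'M[R]_N;
  weight_sym : forall i j, weight i j = weight j i;
  weight_diag : forall i, weight i i = 0;
  weight_ge0 : forall i j, 0 <= weight i j;
  weight_edge : forall i j, (weight i j != 0) = edge i j
}.

Definition degree_matrix (R : realType) (N : nat) (G : weighted_graph R N) :
    'M[R]_N :=
  diag_mx (\row_i \sum_j weight G i j).

Definition laplacian (R : realType) (N : nat) (G : weighted_graph R N) :
    'M[R]_N :=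
  degree_matrix G - weight G.

(* The eigenvectors chi l may be genuinely complex.  The Laplacian acts on
   column vectors, whence the transposes in laplacian_eigen. *)
Record laplacian_eigenbasis (R : realType) (N : nat) (G : weighted_graph R N)
    (lambda : 'I_N -> R) (chi : 'I_N -> 'rV[R[i]]_N) : Prop :=
  LaplacianEigenbasis {
  chi_basis : basis_of fullv [seq chi l | l : 'I_N];
  chi_orthonormal : forall k l, dotmx (chi k) (chi l) = (k == l)%:R;
  laplacian_eigen : forall l,
    map_mx (real_complex R) (laplacian G) *m (chi l)^T
      = real_complex R (lambda l) *: (chi l)^T;
  lambda_zero : forall l : 'I_N, l = 0%N :> nat -> lambda l = 0;
  lambda_pos : forall l : 'I_N, (0 < l)%N -> 0 < lambda l;
  lambda_nondecr : forall k l : 'I_N, (k <= l)%N -> lambda k <= lambda l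
}.

Definition graph_fourier (R : realType) (N : nat)
    (chi : 'I_N -> 'rV[R[i]]_N) (f : 'rV[R[i]]_N) (l : 'I_N) : R[i] :=
  dotmx f (chi l).

Definition translation (R : realType) (N : nat)
    (chi : 'I_N -> 'rV[R[i]]_N) (n : 'I_N) (f : 'rV[R[i]]_N) : 'rV[R[i]]_N :=
  \row_i (sqrtC N%:R *
          \sum_(l < N) graph_fourier chi f l * (chi l 0 n)^* * chi l 0 i).

Definition modulation (R : realType) (N : nat)
    (chi : 'I_N -> 'rV[R[i]]_N) (k : 'I_N) (f : 'rV[R[i]]_N) : 'rV[R[i]]_N :=
  \row_i (sqrtC N%:R * f 0 i * chi k 0 i).

Definition wgf_atom (R : realType) (N : nat)
    (chi : 'I_N -> 'rV[R[i]]_N) (g : 'rV[R[i]]_N) (n k : 'I_N) :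
    'rV[R[i]]_N :=
  modulation chi k (translation chi n g).

(* Main.v *)
Require Import Defs.
From HB Require Import structures.
From mathcomp Require Import all_boot all_order all_algebra.
From mathcomp Require Import sesquilinear spectral.
From mathcomp Require Import complex reals.
From mathcomp Require Import ring.

Import Order.TTheory GRing.Theory Num.Theory.
Local Open Scope ring_scope.

(** The atoms resolve [f] because the eigenbasis is used twice.  In
[\sum_k <f, g_{n,k}> gamma_{n,k}(i)] the modulations contribute the kernel
[\sum_k chi_k(i) (chi_k(j))^*], which is the Kronecker delta since an
orthonormal family of full size is complete ([orthonormal_complete]); hence
the sum collapses to [N f(i) (T_n g(i))^* T_n gamma(i)]
([sum_modulation_atoms]).  What remains is to sum over the translation
parameter [n] at a fixed point [i], whereas the normalisation
[<T_i gamma, T_i g>] fixes the parameter and sums over the points.  Both equal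
[N \sum_l \hat gamma(l) (\hat g(l))^* |chi_l(i)|^2], by Parseval for the basis
[chi] in one case and for the conjugate basis in the other
([translation_exchange]).  The translates themselves need not be symmetric in
[n] and [i], as the [chi_l] may be complex. *)

Lemma dotmx_sum (R : realType) (N : nat) (f h : 'rV[R[i]]_N) :
  dotmx f h = \sum_j f 0 j * (h 0 j)^*.
Proof. by rewrite dotmxE mxE; apply: eq_bigr => j _; rewrite !mxE. Qed.

Lemma sqrtC_nat_mul_conj (R : realType) (N : nat) :
  sqrtC N%:R * (sqrtC N%:R)^* = N%:R :> R[i].
Proof. by rewrite -normCK ger0_norm ?sqrtC_ge0 ?ler0n // sqrtCK. Qed.

Section OrthonormalFamily.

Variables (R : realType) (N : nat) (chi : 'I_N -> 'rV[R[i]]_N).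
Hypothesis chi_on : forall k l, dotmx (chi k) (chi l) = (k == l)%:R.

(** For the matrix [U] with rows [chi k], orthonormality says that the conjugate
transpose is a right inverse of [U]; for a square matrix it is then also a left
inverse, which is the claim. *)
Lemma orthonormal_complete (i j : 'I_N) :
  \sum_k chi k 0 i * (chi k 0 j)^* = (i == j)%:R.
Proof.
pose U := \matrix_(k, i) chi k 0 i.
pose V := \matrix_(i, k) (chi k 0 i)^*.
have UV : U *m V = 1%:M.
  apply/matrixP => k l; rewrite !mxE -chi_on dotmx_sum.
  by apply: eq_bigr => m _; rewrite !mxE.
have /matrixP/(_ j i) := mulmx1C UV.
rewrite !mxE eq_sym => <-.
by apply: eq_bigr => k _; rewrite !mxE mulrC.
Qed.

Lemma parseval_synthesis (a b : 'I_N -> R[i]) :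
  \sum_m (\sum_l a l * chi l 0 m) * (\sum_l b l * chi l 0 m)^* =
  \sum_l a l * (b l)^*.
Proof.
under eq_bigr do rewrite rmorph_sum mulr_suml.
rewrite exchange_big; apply: eq_bigr => k _ /=.
under eq_bigr do rewrite mulr_sumr.
rewrite exchange_big (bigD1 k) //= [X in _ + X]big1 ?addr0 => [|l lk].
  transitivity (a k * (b k)^* * dotmx (chi k) (chi k)).
    rewrite dotmx_sum mulr_sumr; apply: eq_bigr => m _.
    by rewrite rmorphM mulrACA.
  by rewrite chi_on eqxx mulr1.
transitivity (a k * (b l)^* * dotmx (chi k) (chi l)).
  rewrite dotmx_sum mulr_sumr; apply: eq_bigr => m _.
  by rewrite rmorphM mulrACA.
by rewrite chi_on eq_sym (negPf lk) mulr0.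
Qed.

End OrthonormalFamily.

Section WindowedFourier.

Variables (R : realType) (N : nat) (chi : 'I_N -> 'rV[R[i]]_N).
Hypothesis chi_on : forall k l, dotmx (chi k) (chi l) = (k == l)%:R.

(** Both sides are the same spectral sum.  On the left the functions of the
summation index [n] are the conjugates of the [chi l], on the right they are the
[chi l] themselves; each family is orthonormal, so Parseval applies to both, and
the factors left over at [i] have the same modulus [|chi_l(i)|]. *)
Lemma translation_exchange (gamma g : 'rV[R[i]]_N) (i : 'I_N) :
  \sum_n translation chi n gamma 0 i * (translation chi n g 0 i)^* =
  dotmx (translation chi i gamma) (translation chi i g).
Proof.
pose psi l : 'rV[R[i]]_N := \row_m (chi l 0 m)^*.
have psi_on k l : dotmx (psi k) (psi l) = (k == l)%:R.
  rewrite -[RHS]conjC_nat -chi_on !dotmx_sum rmorph_sum.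
  by apply: eq_bigr => m _; rewrite !mxE rmorphM.
pose F h := graph_fourier chi h.
transitivity (N%:R * \sum_m
    (\sum_l (F gamma l * chi l 0 i) * psi l 0 m) *
    (\sum_l (F g l * chi l 0 i) * psi l 0 m)^*).
  rewrite mulr_sumr; apply: eq_bigr => m _.
  rewrite !mxE rmorphM mulrACA sqrtC_nat_mul_conj.
  by congr (_ * (_ * _^*)); apply: eq_bigr => l _; rewrite mxE mulrAC.
transitivity (N%:R * \sum_m
    (\sum_l (F gamma l * (chi l 0 i)^*) * chi l 0 m) *
    (\sum_l (F g l * (chi l 0 i)^*) * chi l 0 m)^*); last first.
  rewrite dotmx_sum mulr_sumr; apply: eq_bigr => m _.
  by rewrite !mxE rmorphM mulrACA sqrtC_nat_mul_conj.
rewrite (parseval_synthesis _ _ _ psi_on) (parseval_synthesis _ _ _ chi_on).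
congr (_ * _); apply: eq_bigr => l _.
by rewrite !rmorphM /= conjCK mulrACA [chi l 0 i * _]mulrC -mulrACA.
Qed.

(** Exchanging the sums over [k] and over the points exposes the reproducing
kernel of the complete family [chi], which localises everything at [i]. *)
Lemma sum_modulation_atoms (f u v : 'rV[R[i]]_N) (i : 'I_N) :
  \sum_k dotmx f (modulation chi k u) * modulation chi k v 0 i =
  N%:R * (f 0 i * (v 0 i * (u 0 i)^*)).
Proof.
pose c j := N%:R * (f 0 j * (v 0 i * (u 0 j)^*)).
transitivity (\sum_k \sum_j c j * (chi k 0 i * (chi k 0 j)^*)).
  apply: eq_bigr => k _; rewrite dotmx_sum mulr_suml.
  apply: eq_bigr => j _; rewrite !mxE !rmorphM /= /c -[in RHS]sqrtC_nat_mul_conj.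
  ring.
rewrite exchange_big; under eq_bigr do rewrite -mulr_sumr orthonormal_complete //.
rewrite (bigD1 i) //= eqxx mulr1 big1 ?addr0 // => j ji.
by rewrite eq_sym (negPf ji) mulr0.
Qed.

Lemma sum_atoms (g gamma f : 'rV[R[i]]_N) (i : 'I_N) :
  \sum_n \sum_k dotmx f (wgf_atom chi g n k) * wgf_atom chi gamma n k 0 i =
  N%:R * dotmx (translation chi i gamma) (translation chi i g) * f 0 i.
Proof.
under eq_bigr do rewrite sum_modulation_atoms.
by rewrite -!mulr_sumr translation_exchange [f 0 i * _]mulrC mulrA.
Qed.

End WindowedFourier.

Theorem theorem3p4 (R : realType) (N : nat) (N_gt0 : (0 < N)%N)
    (G : weighted_graph R N)
    (lambda : 'I_N -> R) (chi : 'I_N -> 'rV[R[i]]_N)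
    (chiP : laplacian_eigenbasis G lambda chi)
    (g gamma : 'rV[R[i]]_N)
    (window_neq0 : forall n : 'I_N,
       dotmx (translation chi n gamma) (translation chi n g) <> 0)
    (f : 'rV[R[i]]_N) (i : 'I_N) :
  f 0 i =
    1 / (N%:R * dotmx (translation chi i gamma) (translation chi i g)) *
    \sum_(n < N) \sum_(k < N)
      dotmx f (wgf_atom chi g n k) * wgf_atom chi gamma n k 0 i.
Proof.
have chi_on := chi_orthonormal chiP.
rewrite (sum_atoms _ _ _ chi_on) mul1r mulKf // mulf_neq0 //.
  by rewrite pnatr_eq0 -lt0n.
exact/eqP.
Qed.
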